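(* Let $p$ be a prime with $p\equiv 3 \pmod 8$. Then there exists a finite solvable group $G$ with $\mathrm{dl}(G)=4$, Fitting height $2$, and $\mathrm{cd}(G)=\{1,2,8,2p^2\}$.
   Context: $\mathrm{cd}(G)$ is the set of degrees of irreducible complex characters of $G$, and $\mathrm{dl}(G)$ is the derived length of $G$. *)

(* Defs.v *)
From mathcomp Require Import all_boot all_algebra all_fingroup all_solvable all_field all_character.
Set Implicit Arguments. Unset Strict Implicit. Unset Printing Implicit Defensive.
Import GRing.Theory Num.Theory.
Local Open Scope group_scope.

Fixpoint upper_fitting (gT : finGroupType) (G : {set gT}) (n : nat) : {set gT} :=
  if n is m.+1 then
    coset (upper_fitting G m) @*^-1 'F(G / upper_fitting G m)
  else 1.

Definition fitting_height_is (gT : finGroupType) (G : {set gT}) (h : nat) : Prop :=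
  upper_fitting G h = G /\ forall m, (m < h)%N -> upper_fitting G m <> G.

Definition derived_length_is (gT : finGroupType) (G : {group gT}) (d : nat) : Prop :=
  G^`(d) = 1 /\ forall m, (m < d)%N -> G^`(m) <> 1.

Local Open Scope ring_scope.
Definition cd (gT : finGroupType) (G : {group gT}) : seq algC :=
  [seq 'chi[G]_i 1%g | i <- enum (Iirr G)].

(* Main.v *)
Require Import Defs.
From HB Require Import structures.
From mathcomp Require Import all_boot all_order all_algebra all_fingroup all_solvable all_field all_character.
Import GRing.Theory Num.Theory.

(** The quaternion group Q = Q8 has a faithful representation rho on
   V = (F_p)^2; it preserves, up to a sign character chi whose kernel is cyclic
   of order 4, a nondegenerate symmetric form on V.  Hence Q acts on the
   Heisenberg group P of order p^5 with P/Z = V + V and with Q acting on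
   Z = Z(P) through chi.  Take G = P : Q.
   The central involution of Q inverts P/Z, so Q acts freely on the nontrivial
   characters of P/Z: by Clifford theory the irreducible characters of G that
   are trivial on Z but not on P have degree 8, while those trivial on P have
   degree 1 or 2.  If Z is not in the kernel, restrict to the abelian normal
   subgroup A = V Z: up to conjugacy, a constituent is trivial on V, its
   inertia group T has index 2 p^2 in G, and T' <= V, so that the
   corresponding character of T is linear and the degree is 2 p^2.
   As the central involution lies in G' and inverts P/Z, both copies of V lie in
   G'' and Z meets G''' nontrivially, whereas the fourth derived subgroup is
   trivial. *)

Section Construction.

Set Implicit Arguments.
Unset Strict Implicit.
Unset Printing Implicit Defensive.
Import Order.TTheory GroupScope GRing.Theory Num.Theory.
Local Open Scope ring_scope.

(** * Characters and Clifford theory *)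

Section CliffordDegree.

Variables (gT : finGroupType) (G A : {group gT}).
Hypothesis nsAG : A <| G.

(** The restriction of ['chi_j] to [N] is a multiple of the principal character, which is therefore
    a constituent of ['chi_i] on [N]; as [N] is normal in [G], Clifford's theorem puts all of [N] in
    the kernel. *)
Lemma sub_cfker_constt_Res (N : {group gT}) i j :
  N <| G -> N \subset A -> j \in irr_constt ('Res[A, G] 'chi_i) ->
  N \subset cfker 'chi_j -> N \subset cfker 'chi_i.
Proof.
move=> nsNG sNA Aij kN; have sAG := normal_sub nsAG.
apply: (constt0_Res_cfker nsNG); rewrite -(cfResRes _ sNA sAG).
apply: (@constt_Res_trans _ _ _ j) => //.
  by rewrite cfRes_char ?irr_char.
rewrite inE cfRes_sub_ker // cfdotZl irr0 -irr0 cfnorm_irr mulr1.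
exact: irr1_neq0.
Qed.

(** By the Clifford correspondence ['chi_i] is induced from some ['chi_s] of the inertia group lying
    over ['chi_j]. By invariance ['chi_s] restricts to a multiple of ['chi_j] on [A], so its kernel
    contains that of ['chi_j], hence the derived subgroup, and ['chi_s] is linear. *)
Lemma irr1_eq_inertia_index i j :
  j \in irr_constt ('Res[A, G] 'chi_i) ->
  ('I_G['chi_j])^`(1)%g \subset cfker 'chi_j ->
  'chi_i 1%g = #|G : 'I_G['chi_j]|%:R.
Proof.
set T := 'I_G['chi_j]%G => Aij kT; have sAG := normal_sub nsAG.
have sTG : T \subset G := Inertia_sub _ _.
have nsAT : A <| T := normal_Inertia _ sAG.
have [irrI _ imI _ _] := constt_Inertia_bijection j nsAG.
have : i \in irr_constt ('Ind[G] 'chi_j) by rewrite constt_Ind_Res.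
rewrite -imI => /imsetP[s Ts ->]; have As := Ts; rewrite constt_Ind_Res in As.
have irrs := irrI s Ts.
rewrite cfIirrE // cfInd1 //.
suff /lin_char1-> : 'chi_s \is a linear_char by rewrite mulr1.
rewrite lin_irr_der1.
have resE : 'Res[A] 'chi_s = '['Res[A] 'chi_s, 'chi_j] *: 'chi_j.
  rewrite {1}(Clifford_Res_sum_cfclass nsAT As).
  by rewrite cfclass_invariant ?subsetIr ?big_seq1.
apply/subsetP=> x /(subsetP kT) kx; have Ax := subsetP (cfker_sub _) _ kx.
rewrite cfkerEirr inE -!(cfResE _ (normal_sub nsAT)) // resE !cfunE.
by rewrite cfker1.
Qed.

(** The irreducible characters of [G / N] have trivial common kernel; one that detects the coset of
    [x] is inflated to [G]. *)
Lemma irr_separates (N : {group gT}) x :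
  N <| G -> x \in G -> x \notin N ->
  exists2 i, N \subset cfker 'chi[G]_i & x \notin cfker 'chi[G]_i.
Proof.
move=> nsNG Gx Nx; have nNx := subsetP (normal_norm nsNG) x Gx.
have: coset N x \notin \bigcap_i cfker 'chi[G / N]_i.
  by rewrite TI_cfker_irr inE; apply: contra Nx => /eqP/(coset_idr nNx).
move/bigcapP => H; have [i ki] : exists i, coset N x \notin cfker 'chi[G / N]_i.
  by apply/existsP; apply: contra_notT H => /existsPn H i _; apply/negPn.
exists (mod_Iirr i); rewrite mod_IirrE ?cfker_mod //.
apply: contra ki; rewrite cfkerEchar ?cfMod_char ?irr_char // inE => /andP[_].
rewrite cfMod1 cfModE // => /eqP xE.
by rewrite cfkerEirr inE xE.
Qed.

End CliffordDegree.

(** * The quaternion group *)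

Definition quaternion : Type := bool * bool * bool.

HB.instance Definition _ := Finite.on quaternion.

(* (e, a, b) encodes (-1)^e i^a j^b. *)
Definition quat_mul (x y : quaternion) : quaternion :=
  let: (e, a, b) := x in let: (e', a', b') := y in
  (e (+) e' (+) a && a' (+) b && b' (+) b && a', a (+) a', b (+) b').

Definition quat_inv (x : quaternion) : quaternion :=
  let: (e, a, b) := x in (e (+) (a || b), a, b).

Fact quat_mulA : associative quat_mul.
Proof. by move=> [[[] []] []] [[[] []] []] [[[] []] []]. Qed.

Fact quat_mul1 : left_id (false, false, false) quat_mul.
Proof. by move=> [[[] []] []]. Qed.

Fact quat_mulV : left_inverse (false, false, false) quat_inv quat_mul.
Proof. by move=> [[[] []] []]. Qed.

HB.instance Definition _ :=
  Finite_isGroup.Build quaternion quat_mulA quat_mul1 quat_mulV.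

Definition quatN1 : quaternion := (true, false, false).

Section QuaternionRepresentation.

Variables (R : comNzRingType) (X Y : 'M[R]_2).
Hypotheses (X2 : X * X = -1) (Y2 : Y * Y = -1) (YX : Y * X = - (X * Y)).

Definition quat_mx (q : quaternion) : 'M[R]_2 :=
  let: (e, a, b) := q in (-1) ^+ e * X ^+ a * Y ^+ b.

(** The exponent of j decides the sign, so this character is trivial on the cyclic subgroup
    generated by i. *)
Definition quat_sign (q : quaternion) : R := (-1) ^+ q.2.

Lemma quat_mx1 : quat_mx 1%g = 1.
Proof. by rewrite /= !mulr1. Qed.

Lemma quat_mxN1 : quat_mx quatN1 = -1.
Proof. by rewrite /= !mulr1. Qed.

Lemma quat_mxM q r : quat_mx (q * r)%g = quat_mx q * quat_mx r.
Proof.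
have X2l Z : Z * X * X = - Z by rewrite -mulrA X2 mulrN1.
have Y2l Z : Z * Y * Y = - Z by rewrite -mulrA Y2 mulrN1.
have YXl Z : Z * Y * X = - (Z * X * Y) by rewrite -mulrA YX mulrN mulrA.
case: q r => [[[] []] []] [[[] []] []] /=;
  by rewrite !(expr0, expr1, mul1r, mulr1, mulN1r, mulrA, mulNr, mulrN, opprK,
               X2l, Y2l, YXl, X2, Y2, YX).
Qed.

Lemma quat_signM q r : quat_sign (q * r)%g = quat_sign q * quat_sign r.
Proof. by case: q r => [[e a] b] [[e' a'] b']; rewrite /quat_sign /= signr_addb. Qed.

End QuaternionRepresentation.

Arguments quat_mx : simpl never.
Arguments quat_sign : simpl never.

(** * The group *)

(* (q, v, w, z) encodes the block matrix
     [[chi q, v, z], [0, rho q, w], [0, 0, 1]],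
   where rho = quat_mx and chi = quat_sign. *)
Definition q8_heis (F : finFieldType) (X Y : 'M[F]_2) (X2 : X * X = -1)
  (Y2 : Y * Y = -1) (YX : Y * X = - (X * Y)) : Type :=
  quaternion * 'rV[F]_2 * 'cV[F]_2 * 'M[F]_1.

Section Group.

Variables (F : finFieldType) (X Y : 'M[F]_2).
Hypotheses (X2 : X * X = -1) (Y2 : Y * Y = -1) (YX : Y * X = - (X * Y)).

Local Notation rho := (quat_mx X Y).
Local Notation chi := (quat_sign F).
Local Notation gT := (q8_heis X2 Y2 YX).

HB.instance Definition _ := Finite.copy gT
  (quaternion * 'rV[F]_2 * 'cV[F]_2 * 'M[F]_1)%type.

Definition q8_heis_mul (x y : gT) : gT :=
  let: (q, v, w, z) := x in let: (q', v', w', z') := y in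
  ((q * q')%g, chi q *: v' + v *m rho q', rho q *m w' + w,
   chi q *: z' + v *m w' + z).

Definition q8_heis_inv (x : gT) : gT :=
  let: (q, v, w, z) := x in let: r := q^-1%g in
  (r, - (chi r *: (v *m rho r)), - (rho r *m w),
   chi r *: (v *m rho r *m w) - chi r *: z).

Definition q8_heis_one : gT := (1%g, 0, 0, 0).

Lemma rhoM q r : rho (q * r)%g = rho q *m rho r.
Proof. exact: quat_mxM. Qed.

Lemma rho1 : rho 1%g = 1%:M.
Proof. exact: quat_mx1. Qed.

Lemma rhoV q : rho q^-1%g *m rho q = 1%:M.
Proof. by rewrite -rhoM mulVg rho1. Qed.

Lemma chi1 : chi 1%g = 1.
Proof. by []. Qed.

Lemma chi_sq q : chi q * chi q = 1.
Proof. by rewrite /quat_sign -signr_addb addbb. Qed.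

Fact q8_heis_mulA : associative q8_heis_mul.
Proof.
move=> [[[q1 v1] w1] z1] [[[q2 v2] w2] z2] [[[q3 v3] w3] z3] /=.
rewrite mulgA !rhoM !quat_signM !scalerDr !mulmxDl !mulmxDr !scalerA.
by rewrite -!scalemxAl !mulmxA !addrA (addrAC _ (chi q1 *: z2) (v1 *m _ *m _)).
Qed.

Fact q8_heis_mul1 : left_id q8_heis_one q8_heis_mul.
Proof.
move=> [[[q v] w] z] /=.
by rewrite mul1g rho1 chi1 !mul0mx !mul1mx !scale1r !addr0.
Qed.

Fact q8_heis_mulV : left_inverse q8_heis_one q8_heis_inv q8_heis_mul.
Proof.
move=> [[[q v] w] z] /=; rewrite mulVg !mulNmx -!scalemxAl.
rewrite -[v *m _ *m rho q]mulmxA rhoV mulmx1.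
by rewrite addrA subrK !subrr.
Qed.

(** Associativity and inverses depend on the relations between [X] and [Y]; carrying their proofs as
    parameters of [q8_heis] lets the group structure be attached to the type. *)
HB.instance Definition _ :=
  Finite_isGroup.Build gT q8_heis_mulA q8_heis_mul1 q8_heis_mulV.

Local Notation mk q v w z := ((q, v, w, z) : gT).

Lemma q8_heisM q v w z q' v' w' z' :
  (mk q v w z * mk q' v' w' z')%g =
  mk (q * q')%g (chi q *: v' + v *m rho q') (rho q *m w' + w)
     (chi q *: z' + v *m w' + z).
Proof. by []. Qed.

Lemma q8_heisJ q v w z u y s :
  (mk 1%g u y s ^ mk q v w z)%g =
  mk 1%g (chi q *: (u *m rho q)) (rho q^-1%g *m y)
     (chi q *: (u *m w + s - v *m rho q^-1%g *m y)).
Proof.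
(* Comparing g (h ^ g) with h g avoids expanding the inverse of g. *)
apply: (mulgI (mk q v w z)); rewrite -conjgC !q8_heisM mulg1 mul1g rho1 chi1.
rewrite !scale1r mul1mx mulmx1 !scalerA chi_sq !scale1r mulmxA -rhoM mulgV.
rewrite rho1 mul1mx mulmxA; congr (_, _, _, _); first exact: addrC.
- exact: addrC.
- by rewrite subrK [RHS]addrC addrA.
Qed.

Local Notation G := [set: gT]%G.

(** * The Heisenberg group and the subgroups used by Clifford theory *)

Definition heis_set := [set x : gT | x.1.1.1 == 1%g].
(** The preimage in [P] of a Lagrangian subspace of [P / Z] for the commutator form. *)
Definition lagr_set := [set x : gT | (x.1.1.1 == 1%g) && (x.1.2 == 0)].
Definition zent_set :=
  [set x : gT | [&& x.1.1.1 == 1%g, x.1.1.2 == 0 & x.1.2 == 0]].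
Definition hor_set :=
  [set x : gT | [&& x.1.1.1 == 1%g, x.1.2 == 0 & x.2 == 0]].
(** The prospective inertia group of a character of [A] that is trivial on [U] but not on [Z]; the
    first condition says that the sign of the quaternion part is 1. *)
Definition stab_set := [set x : gT | ~~ x.1.1.1.2 && (x.1.2 == 0)].

Lemma heis_group_set : group_set heis_set.
Proof.
apply/group_setP; split=> [|[[[q v] w] z] [[[q' v'] w'] z']]; rewrite !inE //=.
by move=> /eqP-> /eqP->; rewrite mulg1.
Qed.
Canonical heis_group := Group heis_group_set.

Lemma lagr_group_set : group_set lagr_set.
Proof.
apply/group_setP; split=> [|[[[q v] w] z] [[[q' v'] w'] z']];
  rewrite !inE ?eqxx //=.
by move=> /andP[/eqP-> /eqP->] /andP[/eqP-> /eqP->]; rewrite mulg1 mulmx0 addr0 !eqxx.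
Qed.
Canonical lagr_group := Group lagr_group_set.

Lemma zent_group_set : group_set zent_set.
Proof.
apply/group_setP; split=> [|[[[q v] w] z] [[[q' v'] w'] z']];
  rewrite !inE ?eqxx //=.
move=> /and3P[/eqP-> /eqP-> /eqP->] /and3P[/eqP-> /eqP-> /eqP->].
by rewrite mulg1 mulmx0 mul0mx scaler0 !addr0 !eqxx.
Qed.
Canonical zent_group := Group zent_group_set.

Lemma hor_group_set : group_set hor_set.
Proof.
apply/group_setP; split=> [|[[[q v] w] z] [[[q' v'] w'] z']];
  rewrite !inE ?eqxx //=.
move=> /and3P[/eqP-> /eqP-> /eqP->] /and3P[/eqP-> /eqP-> /eqP->].
by rewrite mulg1 !mulmx0 scaler0 !addr0 !eqxx.
Qed.
Canonical hor_group := Group hor_group_set.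

Lemma stab_group_set : group_set stab_set.
Proof.
apply/group_setP; split=> [|[[[q v] w] z] [[[q' v'] w'] z']];
  rewrite !inE ?eqxx //=.
case: q q' => [[? ?] []] [[? ?] []] //= /eqP-> /eqP->.
by rewrite mulmx0 addr0 eqxx.
Qed.
Canonical stab_group := Group stab_group_set.

(* U is the copy of V in A = V Z. *)
Local Notation P := heis_group.
Local Notation A := lagr_group.
Local Notation Z := zent_group.
Local Notation U := hor_group.
Local Notation T := stab_group.

Lemma mem_heis x : reflect (exists u y s, x = mk 1%g u y s) (x \in P).
Proof.
rewrite inE; apply: (iffP eqP) => [|[u [y [s ->]]] //].
by case: x => [[[q v] w] z] /= ->; exists v, w, z.
Qed.

Lemma mem_lagr x : reflect (exists u s, x = mk 1%g u 0 s) (x \in A).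
Proof.
rewrite inE; apply: (iffP andP) => [|[u [s ->]]]; last by rewrite !eqxx.
by case: x => [[[q v] w] z] /= [/eqP-> /eqP->]; exists v, z.
Qed.

Lemma mem_zent x : reflect (exists s, x = mk 1%g 0 0 s) (x \in Z).
Proof.
rewrite inE; apply: (iffP and3P) => [|[s ->]]; last by rewrite !eqxx.
by case: x => [[[q v] w] z] /= [/eqP-> /eqP-> /eqP->]; exists z.
Qed.

Lemma mem_hor x : reflect (exists u, x = mk 1%g u 0 0) (x \in U).
Proof.
rewrite inE; apply: (iffP and3P) => [|[u ->]]; last by rewrite !eqxx.
by case: x => [[[q v] w] z] /= [/eqP-> /eqP-> /eqP->]; exists v.
Qed.

Lemma heis_normal : P <| G.
Proof.
rewrite /normal subsetT; apply/subsetP=> [[[[q v] w] z]] _; rewrite inE.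
by apply/subsetP=> _ /imsetP[_ /mem_heis[u [y [s ->]]] ->]; rewrite q8_heisJ inE.
Qed.

Lemma lagr_normal : A <| G.
Proof.
rewrite /normal subsetT; apply/subsetP=> [[[[q v] w] z]] _; rewrite inE.
apply/subsetP=> _ /imsetP[_ /mem_lagr[u [s ->]] ->].
by rewrite q8_heisJ inE /= mulmx0 !eqxx.
Qed.

Lemma zent_normal : Z <| G.
Proof.
rewrite /normal subsetT; apply/subsetP=> [[[[q v] w] z]] _; rewrite inE.
apply/subsetP=> _ /imsetP[_ /mem_zent[s ->] ->].
by rewrite q8_heisJ inE /= mulmx0 mul0mx scaler0 !eqxx.
Qed.

Lemma zent_sub_lagr : Z \subset A.
Proof.
by apply/subsetP=> _ /mem_zent[s ->]; rewrite inE /= !eqxx.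
Qed.

Lemma zent_sub_heis : Z \subset P.
Proof. by apply/subsetP=> _ /mem_zent[s ->]; rewrite inE. Qed.

Lemma hor_sub_lagr : U \subset A.
Proof. by apply/subsetP=> _ /mem_hor[u ->]; rewrite inE /= !eqxx. Qed.

Lemma heisM u y s u' y' s' :
  (mk 1%g u y s * mk 1%g u' y' s')%g =
  mk 1%g (u + u') (y + y') (s + s' + u *m y').
Proof.
rewrite q8_heisM mulg1 rho1 mulmx1 mul1mx chi1 !scale1r.
by congr (_, _, _, _); rewrite 1?addrC // addrA.
Qed.

Lemma lagr_abelian : abelian A.
Proof.
apply/centsP=> _ /mem_lagr[u [s ->]] _ /mem_lagr[u' [s' ->]].
by rewrite /commute !heisM !mulmx0 !addr0 addrC [s + _]addrC.
Qed.

Lemma heis_der1 : P^`(1)%g \subset Z.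
Proof.
rewrite gen_subG; apply/subsetP=> _ /imset2P[_ _ /mem_heis[u [y [s ->]]]
  /mem_heis[u' [y' [s' ->]]] ->].
(* The commutator c is read off from x y = y x c, whose first coordinates are additive. *)
have := commgC (mk 1%g u y s) (mk 1%g u' y' s').
have : [~ mk 1%g u y s, mk 1%g u' y' s']%g \in P by rewrite groupR // inE.
move: [~ _, _]%g => c /mem_heis[a [b [t ->]]].
rewrite heisM (heisM u') heisM.
case=> uE yE _; apply/mem_zent; exists t.
move: uE yE; rewrite [u' + u]addrC [y' + y]addrC.
by rewrite -{1}[u + u']addr0 -{1}[y + y']addr0 => /addrI<- /addrI<-.
Qed.

Lemma zent_central : P \subset 'C(Z).
Proof.
apply/centsP=> _ /mem_heis[u [y [s ->]]] _ /mem_zent[s' ->].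
rewrite /commute !heisM mulmx0 mul0mx !addr0 !add0r.
by rewrite [s + _]addrC.
Qed.

Lemma hor_abelian : abelian U.
Proof. exact: abelianS hor_sub_lagr lagr_abelian. Qed.

(** On [T] the sign is 1 and w = 0, so (q, v, 0, z) -> (q, z) is a homomorphism to the abelian
    product of the group generated by i with the additive group of [F], and its kernel is [U]. *)
Lemma stab_der1 : T^`(1)%g \subset U.
Proof.
rewrite gen_subG; apply/subsetP=> c /imset2P[[[[q v] w] z] [[[q' v'] w'] z']].
rewrite !inE /= => /andP[q2 /eqP->] /andP[q2' /eqP->] -> {c}.
have qq : (q * q')%g = (q' * q)%g.
  by case: q q' q2 q2' => [[[] []] []] [[[] []] []].
have chiq : chi q = 1 by case: q q2 {qq} => [[? ?] []].
have chiq' : chi q' = 1 by case: q' q2' {qq} => [[? ?] []].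
have := commgC (mk q v 0 z) (mk q' v' 0 z').
move: [~ _, _]%g => c.
have [r [a [b [t ->]]]] : exists r a b t, c = mk r a b t.
  by case: c => [[[r a] b] t]; exists r, a, b, t.
rewrite q8_heisM (q8_heisM q') q8_heisM.
rewrite qq !mulmx0 quat_signM chiq chiq' mulr1 !scale1r !addr0.
case=> rE _ /esym bE tE.
have r1 : r = 1%g by apply: (mulgI (q' * q)%g); rewrite mulg1.
have b0 : b = 0.
  move: bE => /(congr1 (mulmx (rho (q' * q)^-1%g))).
  by rewrite mulmxA rhoV mul1mx mulmx0.
rewrite r1 b0 /= !eqxx /=; move: tE; rewrite b0 mulmx0 addr0 => /esym/eqP.
by rewrite -subr_eq0 [z + z']addrC addrK.
Qed.

(** * Orders and indices *)

Lemma card_q8_heis : #|G| = (8 * #|F| ^ 5)%N.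
Proof.
rewrite cardsT !card_prod !card_mx card_bool.
by rewrite -2!(mulnA (2 * 2 * 2)) -!expnD.
Qed.

Lemma card_heis : #|P| = (#|F| ^ 5)%N.
Proof.
pose f (x : 'rV[F]_2 * 'cV[F]_2 * 'M[F]_1) := mk 1%g x.1.1 x.1.2 x.2.
have f_inj : injective f by move=> [[u y] s] [[u' y'] s'] [-> -> ->].
have -> : heis_group = f @: setT :> {set gT}.
  apply/setP=> x; apply/mem_heis/imsetP=> [[u [y [s ->]]]|[[[u y] s] _ ->]].
    by exists (u, y, s).
  by exists u, y, s.
by rewrite card_imset // cardsT !card_prod !card_mx -!expnD.
Qed.

Lemma card_hor : #|U| = (#|F| ^ 2)%N.
Proof.
pose f (u : 'rV[F]_2) := mk 1%g u 0 0.
have f_inj : injective f by move=> u u' [->].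
have -> : hor_group = f @: setT :> {set gT}.
  by apply/setP=> x; apply/mem_hor/imsetP=> [[u ->]|[u _ ->]]; exists u.
by rewrite card_imset // cardsT card_mx.
Qed.

Lemma card_stab : #|T| = (4 * #|F| ^ 3)%N.
Proof.
pose f (x : bool * bool * 'rV[F]_2 * 'M[F]_1) :=
  mk (x.1.1.1, x.1.1.2, false) x.1.2 0 x.2.
have f_inj : injective f by move=> [[[e a] u] s] [[[e' a'] u'] s'] [-> -> -> ->].
have -> : stab_group = f @: setT :> {set gT}.
  apply/setP=> x; apply/idP/imsetP=> [|[y _ ->]]; last by rewrite inE /= eqxx.
  case: x => [[[[[e a] b] v] w] z]; rewrite inE /= => /andP[/negPf-> /eqP->].
  by exists (e, a, v, z).
rewrite card_imset // cardsT !card_prod !card_mx card_bool.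
by rewrite -(mulnA (2 * 2)) -expnD.
Qed.

Lemma index_heis : #|G : P| = 8%N.
Proof.
rewrite -divgS ?subsetT // card_q8_heis card_heis mulnK // expn_gt0.
by rewrite (ltnW (finNzRing_gt1 F)).
Qed.

Lemma index_stab : #|G : T| = (2 * #|F| ^ 2)%N.
Proof.
rewrite -divgS ?subsetT // card_q8_heis card_stab.
rewrite (_ : 8 * _ = 2 * #|F| ^ 2 * (4 * #|F| ^ 3))%N; last first.
  by rewrite mulnACA -expnD.
by rewrite mulnK // muln_gt0 expn_gt0 (ltnW (finNzRing_gt1 F)).
Qed.

Hypothesis F2 : (2%:R : F) != 0.

(** Halving turns invariance under negation into triviality of a character, and makes every vector
    negated by an element a commutator with that element. *)
Lemma mx_double m n (v : 'M[F]_(m, n)) : exists w, v = w + w.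
Proof.
exists (2%:R^-1 *: v); rewrite -scalerDl -mulr2n -[_ *+ 2]mulr_natr mulVf //.
by rewrite scale1r.
Qed.

(** * Irreducible characters not trivial on [Z] *)

Lemma lagr_char_lin (j : Iirr A) : 'chi_j \is a linear_char.
Proof. exact: char_abelianP lagr_abelian j. Qed.

Lemma lagr_charM (j : Iirr A) u s u' s' :
  'chi_j (mk 1%g (u + u') 0 (s + s')) =
  'chi_j (mk 1%g u 0 s) * 'chi_j (mk 1%g u' 0 s').
Proof.
rewrite -(lin_charM (lagr_char_lin j)) ?inE ?eqxx //.
by rewrite heisM mulmx0 !addr0.
Qed.

Lemma lagr_char1 (j : Iirr A) : 'chi_j (mk 1%g 0 0 0) = 1.
Proof. exact: lin_char1 (lagr_char_lin j). Qed.

Lemma sub_zent_cfker (j : Iirr A) :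
  (forall s, 'chi_j (mk 1%g 0 0 s) = 1) -> Z \subset cfker 'chi_j.
Proof.
move=> Zj; apply/subsetP=> _ /mem_zent[s ->].
by rewrite cfkerEirr inE Zj (lin_char1 (lagr_char_lin j)).
Qed.

(* u |-> u w is onto unless w = 0. *)
Lemma lagr_char_pairing (j : Iirr A) (w : 'cV[F]_2) :
  ~~ (Z \subset cfker 'chi_j) ->
  (forall u, 'chi_j (mk 1%g 0 0 (u *m w)) = 1) -> w = 0.
Proof.
move=> nZj uw; apply/eqP; apply: contraR nZj => w0; apply: sub_zent_cfker => s.
have [i wi] : exists i, w i 0 != 0.
  apply/existsP; apply: contraR w0 => /existsPn w0; apply/eqP/colP=> i.
  by rewrite mxE; apply/eqP/negPn/w0.
rewrite -(uw (s 0 0 / w i 0 *: delta_mx 0 i)); congr ('chi_j (mk _ _ _ _)).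
apply/matrixP=> a b; rewrite !ord1 -scalemxAl -rowE !mxE.
by rewrite mulfVK.
Qed.

(** The value at 2t is the square of the value at t, which equals the product of the values at -t
    and t, that is 1. *)
Lemma lagr_char_neg (j : Iirr A) :
  (forall s, 'chi_j (mk 1%g 0 0 (- s)) = 'chi_j (mk 1%g 0 0 s)) ->
  Z \subset cfker 'chi_j.
Proof.
move=> negj; apply: sub_zent_cfker => s; have [t ->] := mx_double s.
have := lagr_charM j 0 t 0 t; rewrite addr0 => ->.
by rewrite -{1}negj -lagr_charM addNr addr0 lagr_char1.
Qed.

(** Such a character depends only on the central coordinate. Invariance under (q, v, w, z) equates
    its values at chi(q) (u w + s) and at s: taking u = 0 excludes chi(q) = -1 by [lagr_char_neg],
    and then s = 0 forces w = 0 by [lagr_char_pairing]. *)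
Lemma inertia_stab (j : Iirr A) :
  ~~ (Z \subset cfker 'chi_j) ->
  (forall u, 'chi_j (mk 1%g u 0 0) = 1) -> 'I_G['chi_j] = T.
Proof.
move=> nZj Uj.
have charE u s : 'chi_j (mk 1%g u 0 s) = 'chi_j (mk 1%g 0 0 s).
  by rewrite -[u]addr0 -[s in LHS]add0r lagr_charM Uj mul1r.
apply/eqP; rewrite eqEsubset; apply/andP; split; apply/subsetP.
  move=> [[[q v] w] z] /setIP[_ Ix]; rewrite inE /=.
  have Js u s : 'chi_j (mk 1%g 0 0 (chi q *: (u *m w + s))) =
                'chi_j (mk 1%g 0 0 s).
    rewrite -(charE u s) -(inertia_valJ (mk 1%g u 0 s) Ix) q8_heisJ.
    by rewrite mulmx0 charE !mulmx0 subr0.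
  have chiq : chi q = 1.
    case qb : q.2; last by rewrite /quat_sign qb.
    case/negP: nZj; apply: lagr_char_neg => s.
    have := Js 0 s; rewrite mul0mx add0r /quat_sign qb expr1.
    by rewrite scaleN1r.
  have -> : w = 0.
    apply: (lagr_char_pairing nZj) => u.
    by have := Js u 0; rewrite chiq scale1r addr0 lagr_char1.
  (* If j occurred in q, then chi(q) = 1 would read -1 = 1, against [F2]. *)
  rewrite eqxx andbT; apply/negP=> qb; move/eqP: chiq.
  rewrite /quat_sign qb expr1 eq_sym -subr_eq0 opprK -(natrD _ 1 1).
  by rewrite (negPf F2).
move=> x Tx; rewrite inE in_setT /=.
have nAG : {subset G <= 'N(A)} := subsetP (normal_norm lagr_normal).
rewrite inE (nAG _ (in_setT _)) /=; apply/eqP/cfun_inP=> a Aa.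
rewrite cfConjgE ?nAG //; move: Tx; rewrite -groupV.
case: x^-1%g => [[[q v] w] z]; rewrite inE /= => /andP[qb /eqP->].
case/mem_lagr: Aa => u [s ->]; rewrite q8_heisJ !mulmx0 add0r subr0 !charE.
by rewrite /quat_sign (negPf qb) scale1r.
Qed.

(* The conjugates of 'chi_j by the elements (1, 0, w, 0) restrict to #|U|
   distinct characters of U, so one of these restrictions is trivial. *)
Lemma constt_trivial_on_hor (i : Iirr G) (j : Iirr A) :
  j \in irr_constt ('Res[A] 'chi_i) -> ~~ (Z \subset cfker 'chi_j) ->
  exists k, [/\ k \in irr_constt ('Res[A] 'chi_i),
    ~~ (Z \subset cfker 'chi_k) & forall u, 'chi_k (mk 1%g u 0 0) = 1].
Proof.
move=> Aij nZj; pose e (w : 'cV[F]_2) := mk 1%g 0 w 0.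
have nAe w : e w \in 'N(A).
  exact: subsetP (normal_norm lagr_normal) _ (in_setT _).
have eE w u s : ('chi_j ^ e w)%CF (mk 1%g u 0 s) =
                'chi_j (mk 1%g u 0 (s - u *m w)).
  rewrite cfConjgE // (_ : (e w)^-1%g = e (- w)); last first.
    apply/eqP; rewrite eq_invg_mul /e heisM.
    by rewrite !addr0 subrr mul0mx addr0.
  rewrite q8_heisJ chi1 rho1 mulmx1 !scale1r !mulmx0 subr0.
  by rewrite mulmxN addrC.
pose f w := cfIirr ('Res[U] ('chi_j ^ e w)).
have fE w u : 'chi_(f w) (mk 1%g u 0 0) = 'chi_j (mk 1%g u 0 (- (u *m w))).
  rewrite cfIirrE; last first.
    by rewrite lin_char_irr ?cfRes_lin_char ?cfConjg_lin_char ?lagr_char_lin.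
  rewrite cfResE ?hor_sub_lagr //; last by apply/mem_hor; exists u.
  by rewrite eE add0r.
have f_inj : injective f.
  move=> w w' ff; apply/eqP; rewrite -subr_eq0; apply/eqP.
  apply: (lagr_char_pairing nZj) => u; rewrite mulmxBr.
  have := congr1 (fun k => 'chi_k (mk 1%g u 0 0)) ff; rewrite !fE => uE.
  (* Dividing the equal values at (u, -u w) and (u, -u w') cancels u and leaves the value at u w - u
     w'. *)
  have := lagr_charM j u (- (u *m w)) (- u) (u *m w).
  by rewrite uE -lagr_charM !addrN addNr lagr_char1 addrC => ->.
have [w fw0] : exists w, f w = 0.
  suff /(inj_card_onto f_inj)/(_ 0)/codomP[w fw] :
    (#|Iirr U| <= #|{: 'cV[F]_2}|)%N by exists w.
  by rewrite card_Iirr_abelian ?hor_abelian // card_hor card_mx.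
exists (conjg_Iirr j (e w)); split.
- by rewrite irr_consttE conjg_IirrE cfdot_Res_conjg ?in_setT.
- rewrite conjg_IirrE cfker_conjg //.
  apply: contra nZj => Zk; rewrite -(conjSg _ _ (e w)).
  apply: subset_trans Zk; apply/subsetP.
  by move=> x; rewrite (normP (subsetP (normal_norm zent_normal) _ (in_setT _))).
- move=> u; rewrite conjg_IirrE eE add0r -fE fw0 irr0 cfun1E.
  by rewrite (introT (mem_hor _)) //; exists u.
Qed.

Lemma irr1_zent_notin_ker (i : Iirr G) :
  ~~ (Z \subset cfker 'chi_i) -> 'chi_i 1%g = (2 * #|F| ^ 2)%N%:R.
Proof.
move=> nZi; have nsAG := lagr_normal.
have /neq0_has_constt[j Aij] : 'Res[A] 'chi_i != 0.
  exact: Res_irr_neq0.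
have nZj : ~~ (Z \subset cfker 'chi_j).
  apply: contra nZi; apply: sub_cfker_constt_Res Aij => //.
    exact: zent_normal.
  exact: zent_sub_lagr.
have [k [Aik nZk Uk]] := constt_trivial_on_hor Aij nZj.
have TE := inertia_stab nZk Uk.
rewrite (irr1_eq_inertia_index nsAG Aik) TE ?index_stab //.
apply: subset_trans stab_der1 _; apply/subsetP=> _ /mem_hor[u ->].
by rewrite cfkerEirr inE Uk (lin_char1 (lagr_char_lin k)).
Qed.

(** * Irreducible characters trivial on [Z] *)

Lemma quatN1_power (q : quaternion) : q != 1%g -> q = quatN1 \/ (q * q)%g = quatN1.
Proof. by case: q => [[[] []] []]; auto. Qed.

Lemma q8_heisJN1 v w z u y s :
  exists s', (mk 1%g u y s ^ mk quatN1 v w z)%g = mk 1%g (- u) (- y) s'.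
Proof.
rewrite q8_heisJ (_ : quatN1^-1%g = quatN1) // (quat_mxN1 X Y).
by rewrite mulmxN mulmx1 mulNmx mul1mx scale1r; eexists.
Qed.

(* An element of G over -1 inverts P modulo Z, and squaring is onto in P / Z. *)
Lemma heis_char_inertiaN1 (j : Iirr P) t :
  Z \subset cfker 'chi_j -> t \in 'I['chi_j] -> t.1.1.1 = quatN1 ->
  P \subset cfker 'chi_j.
Proof.
move=> Zj It tq; have linj : 'chi_j \is a linear_char.
  by rewrite lin_irr_der1 (subset_trans heis_der1).
have P1 u y s : mk 1%g u y s \in P by rewrite inE.
have Z1 s : 'chi_j (mk 1%g 0 0 s) = 1.
  rewrite cfker1 ?(lin_char1 linj) //.
  by apply: subsetP Zj _ _; apply/mem_zent; exists s.
apply/subsetP=> _ /mem_heis[u [y [s ->]]].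
rewrite cfkerEirr inE (lin_char1 linj).
have [u' ->] := mx_double u; have [y' ->] := mx_double y.
(* The square of (u', y', 0) has central coordinate [u' *m y']; the last factor, on which the
   character is 1, corrects it. *)
have -> : mk 1%g (u' + u') (y' + y') s =
  (mk 1%g u' y' 0 * mk 1%g u' y' 0 * mk 1%g 0 0 (s - u' *m y'))%g.
  rewrite (heisM u') heisM; congr (_, _, _, _);
    by rewrite ?mulmx0 ?addr0 // add0r addrC subrK.
rewrite !(lin_charM linj) ?groupM // Z1 mulr1.
rewrite -{2}(inertia_valJ _ It); case: t tq {It} => [[[q v] w] z] /= ->.
have [s' ->] := q8_heisJN1 v w z u' y' 0.
by rewrite -(lin_charM linj) // heisM !addrN Z1.
Qed.

Lemma irr1_zent_in_ker (i : Iirr G) :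
  Z \subset cfker 'chi_i -> ~~ (P \subset cfker 'chi_i) -> 'chi_i 1%g = 8%:R.
Proof.
move=> Zi nPi; have nsPG := heis_normal; have sPG := normal_sub nsPG.
have /neq0_has_constt[j Pij] : 'Res[P] 'chi_i != 0 by apply: Res_irr_neq0.
have Zj : Z \subset cfker 'chi_j.
  apply: subset_trans (cfker_constt _ Pij); last by rewrite cfRes_char ?irr_char.
  by rewrite cfker_Res ?irr_char // subsetI zent_sub_heis.
have nPj : ~~ (P \subset cfker 'chi_j).
  by apply: contra nPi; apply: sub_cfker_constt_Res Pij.
have TE : 'I_G['chi_j] = P.
  apply/eqP; rewrite eqEsubset sub_Inertia // andbT.
  apply/subsetP=> x /setIP[_ Ix]; rewrite inE; apply: contraR nPj.
  (* As -1 is the only involution of Q, an element of the inertia group outside [P], or its square,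
     lies over -1. *)
  case/quatN1_power=> [qx|qx]; first exact: heis_char_inertiaN1 Ix qx.
  apply: (heis_char_inertiaN1 Zj (groupM Ix Ix)).
  by case: x qx {Ix} => [[[q v] w] z].
rewrite (irr1_eq_inertia_index nsPG Pij) TE ?index_heis //.
exact: subset_trans heis_der1 Zj.
Qed.

(** The square of the degree is at most the index of the centre of the character, which contains
    [P]; so it is at most 8, hence below 9. *)
Lemma irr1_heis_in_ker (i : Iirr G) :
  P \subset cfker 'chi_i -> 'chi_i 1%g = 1 \/ 'chi_i 1%g = 2%:R.
Proof.
move=> Pi; have [n nE] := natrP (Cnat_irr1 i).
have n0 : (0 < n)%N by rewrite -(ltr_nat algC) -nE irr1_gt0.
suff : (n ^ 2 < 3 ^ 2)%N.
  rewrite ltn_sqr; case: n n0 nE => [|[|[|n]]] // _ -> _; [by left|by right].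
change (n ^ 2 <= 8)%N.
rewrite -index_heis -(ler_nat algC) natrX -nE.
apply: le_trans (irr1_bound i) _; rewrite ler_nat dvdn_leq ?indexgS //.
exact: subset_trans Pi (normal_sub (cfker_center_normal _)).
Qed.

(** * The derived series *)

Local Notation e := (mk quatN1 0 0 0).

(** Here z is the commutator of x and y, so conjugation formulas suffice to exhibit commutators. *)
Lemma mem_commg_eq (H K : {group gT}) x y z :
  x \in H -> y \in K -> (x ^ y = x * z)%g -> z \in [~: H, K]%g.
Proof.
by move=> Hx Ky xyE; rewrite -(mulKg x z) -xyE -commgEl mem_commg.
Qed.

Lemma heisJN1 u y s :
  (mk 1%g u y s ^ e)%g = mk 1%g (- u) (- y) s.
Proof.
rewrite q8_heisJ (_ : quatN1^-1%g = quatN1) // (quat_mxN1 X Y).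
rewrite (_ : chi quatN1 = 1) // !(mulmxN, mulNmx, mulmx1, mul1mx, mul0mx, mulmx0).
by rewrite !(oppr0, add0r, addr0, scale1r).
Qed.

(** Conjugation by [e] negates u, so the commutator of -c with [e] is 2c, and every vector is of
    this form. *)
Lemma hor_commg (H K : {group gT}) a :
  (forall u, mk 1%g u 0 0 \in H) -> e \in K -> mk 1%g a 0 0 \in [~: H, K]%g.
Proof.
move=> HU Ke; have [c ->] := mx_double a.
apply: (mem_commg_eq (HU (- c)) Ke).
by rewrite heisJN1 heisM addKr mulmx0 !addr0 oppr0 opprK.
Qed.

Lemma ver_commg (H K : {group gT}) b :
  (forall y, mk 1%g 0 y 0 \in H) -> e \in K -> mk 1%g 0 b 0 \in [~: H, K]%g.
Proof.
move=> HV Ke; have [c ->] := mx_double b.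
apply: (mem_commg_eq (HV (- c)) Ke).
by rewrite heisJN1 heisM addKr mul0mx !addr0 oppr0 opprK.
Qed.

Lemma quatN1_in_der1 : e \in G^`(1)%g.
Proof.
rewrite derg1; pose qi : quaternion := (false, true, false).
pose qj : quaternion := (false, false, true).
(* In Q, -1 is the commutator of i and j. *)
have eE : ((mk qi 0 0 0) ^ (mk qj 0 0 0) = mk qi 0 0 0 * e)%g.
  apply: (mulgI (mk qj 0 0 0)); rewrite -conjgC.
  rewrite (q8_heisM qi 0 0 0 quatN1) !q8_heisM.
  by rewrite !(mul0mx, mulmx0, scaler0, addr0).
by apply: mem_commg_eq eE; rewrite inE.
Qed.

(** Commutation with [e] reproduces both copies of V. As [e] lies in the first derived subgroup,
    doing this in [G] and then in that subgroup keeps them down to the second. *)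
Lemma der2_hor_ver :
  (forall u, mk 1%g u 0 0 \in G^`(2)%g) /\ (forall y, mk 1%g 0 y 0 \in G^`(2)%g).
Proof.
split=> [u|y].
  apply: (hor_commg (H := G^`(1)) (K := G^`(1))) quatN1_in_der1 => v.
  by apply: (hor_commg (H := G) (K := G)) => [?|]; rewrite inE.
apply: (ver_commg (H := G^`(1)) (K := G^`(1))) quatN1_in_der1 => v.
by apply: (ver_commg (H := G) (K := G)) => [?|]; rewrite inE.
Qed.

Lemma der3_neq1 : G^`(3)%g <> 1%g.
Proof.
move=> G3; have [GU GV] := der2_hor_ver.
(* These vectors pair to 1, so the commutator of the corresponding elements of the two copies of V
   is a nontrivial element of [Z]. *)
pose a : 'rV[F]_2 := delta_mx 0 0; pose b : 'cV[F]_2 := delta_mx 0 0.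
have : mk 1%g 0 0 (a *m b) \in G^`(3)%g.
  apply: (mem_commg_eq (GV b) (GU (- a))).
  rewrite q8_heisJ heisM chi1 invg1 rho1.
  by rewrite !(mulmx1, mul1mx, mul0mx, mulNmx, scale1r, addr0, add0r, opprK).
rewrite G3 inE => /eqP[] /matrixP/(_ 0 0)/eqP.
by rewrite mul_delta_mx !mxE !eqxx oner_eq0.
Qed.

Lemma quat_der2 : [set: quaternion]^`(2)%g = 1%g.
Proof.
have sub : [set: quaternion]^`(1)%g \subset <[quatN1]>%g.
  rewrite gen_subG; apply/subsetP=> _ /imset2P[x y _ _ ->].
  suff : [~ x, y]%g \in [:: 1%g; quatN1].
    by rewrite !inE => /orP[/eqP->|/eqP->]; rewrite ?group1 ?cycle_id.
  by case: x y => [[[] []] []] [[[] []] []].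
have := dergS 1 sub; rewrite (derG1P (cycle_abelian _)) => ?.
exact/trivgP.
Qed.

Lemma quat_projM : {in G &, {morph (fun x : gT => x.1.1.1) : x y / (x * y)%g}}.
Proof. by move=> [[[q v] w] z] [[[q' v'] w'] z']. Qed.
Canonical quat_proj := Morphism quat_projM.

Lemma der2_sub_heis : G^`(2)%g \subset P.
Proof.
apply/subsetP=> x Gx; suff: quat_proj x \in [set: quaternion]^`(2)%g.
  by rewrite quat_der2 !inE.
apply: subsetP (dergS 2 (subsetT (quat_proj @* G))) _ _.
by rewrite -morphim_der // mem_morphim ?inE.
Qed.

Lemma der4_eq1 : G^`(4)%g = 1%g.
Proof.
have sub : G^`(3)%g \subset A.
  apply: subset_trans (dergS 1 der2_sub_heis) _.
  exact: subset_trans heis_der1 zent_sub_lagr.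
have := dergS 1 sub; rewrite (derG1P lagr_abelian) => ?.
exact/trivgP.
Qed.

Lemma q8_heis_derived_length : derived_length_is G 4.
Proof.
split=> [|m m4 Gm]; first exact: der4_eq1.
apply: der3_neq1; apply/trivgP; rewrite -Gm.
case: m m4 {Gm} => [|[|[|[|]]]] // _.
- exact: der_sub 3 G.
- exact: der_sub 2 G^`(1)%G.
- exact: der_sub 1 G^`(2)%G.
Qed.

Lemma q8_heis_solvable : solvable G.
Proof. by apply/derivedP; exists 4; rewrite der4_eq1. Qed.

(** * Fitting height *)

Lemma heis_nilpotent : nilpotent P.
Proof.
apply/lcnP; exists 2; apply/eqP; rewrite lcnSn -subG1.
apply: subset_trans (commSg P heis_der1) _.
by rewrite subG1; apply/eqP/commG1P; rewrite centsC zent_central.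
Qed.

Lemma q8_heis_not_nilpotent : ~~ nilpotent G.
Proof.
(* [nilpotent] requires every subgroup H contained in [H, G] to be trivial; [U] violates this
   because [e] inverts it. *)
apply/negP=> /forallP/(_ U); rewrite subsetI subsetT /=.
have -> : U \subset [~: U, G]%g.
  apply/subsetP=> _ /mem_hor[u ->]; apply: hor_commg => [v|]; rewrite ?inE //.
  by rewrite /= !eqxx.
rewrite /= trivg_card1 card_hor -[1%N](exp1n 2) eqn_exp2r //.
by rewrite gtn_eqF ?finNzRing_gt1.
Qed.

(** The first step is a Fitting subgroup of the quotient by 1, transported back along an injective
    coset map. *)
Lemma upper_fitting1 (hT : finGroupType) (H : {group hT}) :
  upper_fitting H 1 = 'F(H)%g.
Proof.
rewrite /= -injmF ?norms1 ?coset1_injm //.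
by rewrite -[_ @* _]/('F(H) / 1)%g quotientGK // /normal sub1G norms1.
Qed.

(** The Fitting subgroup contains the normal nilpotent subgroup [P] of index 8, so the quotient by
    it is a 2-group, hence nilpotent. Heights 0 and 1 would make [G] trivial or nilpotent. *)
Lemma q8_heis_fitting_height : fitting_height_is G 2.
Proof.
have nilPF : P \subset 'F(G)%g by rewrite Fitting_max ?heis_normal ?heis_nilpotent.
split=> [|[|[|]] // _].
- rewrite -[LHS]/(coset (upper_fitting G 1) @*^-1 'F(G / upper_fitting G 1))%g.
  rewrite upper_fitting1 (@nilpotent_Fitting _ (G / 'F(G))).
    by rewrite quotientGK ?Fitting_normal.
  apply: (pgroup_nil (p := 2)); rewrite /pgroup card_quotient ?gFnorm //.
  apply: (@pnat_dvd _ #|G : P|); first exact: indexgS.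
  by rewrite index_heis.
- rewrite /= => G1; case: der3_neq1; apply/trivgP.
  by apply: subset_trans (der_sub 3 G) _; rewrite subG1; apply/eqP/esym.
- rewrite upper_fitting1 => FG; case/negP: q8_heis_not_nilpotent.
  by have := Fitting_nil G; rewrite FG.
Qed.

(** * The set of character degrees *)

Lemma irr1_eq2_exists : exists i : Iirr G, 'chi_i 1%g = 2%:R.
Proof.
have [||i Pi ei] := irr_separates (x := e) heis_normal; rewrite ?inE //.
exists i; case: (irr1_heis_in_ker Pi) => // i1; case/negP: ei.
have lini : 'chi_i \is a linear_char by apply/andP; rewrite irr_char i1.
(* A linear character would be trivial on the derived subgroup, which contains [e]. *)
by move: lini; rewrite lin_irr_der1 => /subsetP; apply; apply: quatN1_in_der1.
Qed.

Lemma irr1_eq8_exists : exists i : Iirr G, 'chi_i 1%g = 8%:R.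
Proof.
(* The chosen element lies in [P] but not in [Z], so the character found is trivial on [Z] and not
   on [P]. *)
have [||i Zi xi] := irr_separates (x := mk 1%g (delta_mx 0 0) 0 0) zent_normal.
- by rewrite inE.
- rewrite inE /= !eqxx andbT /=; apply/eqP=> /matrixP/(_ 0 0)/eqP.
  by rewrite !mxE !eqxx oner_eq0.
- exists i; apply: irr1_zent_in_ker => //; apply: contra xi => /subsetP; apply.
  by rewrite inE.
Qed.

Lemma irr1_eq2q2_exists : exists i : Iirr G, 'chi_i 1%g = (2 * #|F| ^ 2)%N%:R.
Proof.
have [||i _ xi] := irr_separates (x := mk 1%g 0 0 1%:M) (normal1 G).
- by rewrite inE.
- rewrite inE; apply/eqP=> - [] /matrixP/(_ 0 0)/eqP.
  by rewrite !mxE oner_eq0.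
- exists i; apply: irr1_zent_notin_ker; apply: contra xi => /subsetP; apply.
  by apply/mem_zent; exists 1%:M.
Qed.

Lemma cd_q8_heis :
  cd G =i [:: 1; 2%:R; 8%:R; (2 * #|F| ^ 2)%N%:R].
Proof.
move=> x; rewrite !inE; apply/mapP/idP=> [[i _ ->]|].
  have [Zi | /irr1_zent_notin_ker->] := boolP (Z \subset cfker 'chi_i); last first.
    by rewrite eqxx !orbT.
  have [/irr1_heis_in_ker[]->| nPi] := boolP (P \subset cfker 'chi_i).
  - by rewrite eqxx.
  - by rewrite eqxx orbT.
  - by rewrite irr1_zent_in_ker // eqxx !orbT.
case/or4P=> /eqP->.
- by exists 0; rewrite ?mem_enum // irr0 cfun11.
- by have [i <-] := irr1_eq2_exists; exists i; rewrite ?mem_enum.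
- by have [i <-] := irr1_eq8_exists; exists i; rewrite ?mem_enum.
- by have [i <-] := irr1_eq2q2_exists; exists i; rewrite ?mem_enum.
Qed.
End Group.

(** * Quaternion matrices over a prime field *)

Lemma Fp_natr_inj p (m n : nat) :
  prime p -> (m < p)%N -> (n < p)%N -> m%:R = n%:R :> 'F_p -> m = n.
Proof.
move=> pr_p mp np /(congr1 val) /=.
by rewrite !val_Fp_nat // !modn_small.
Qed.

(* The sets {x^2} and {-1 - y^2} are too large to be disjoint. *)
Lemma Fp_sum_two_squares p :
  prime p -> odd p -> exists a b : 'F_p, a ^+ 2 + b ^+ 2 = -1.
Proof.
(* With p = 2h + 1, the squares of 0, ..., h are distinct, and two sets of h + 1 elements have p + 1
   in total. *)
move=> pr_p odd_p; pose h := p./2.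
have pE : p = (h + h).+1 by rewrite -[p in LHS]odd_double_half odd_p -addnn.
have ltp (i : 'I_h.+1) : (i < p)%N.
  by rewrite pE ltnS (leq_trans _ (leq_addr _ _)) // -ltnS.
pose f (i : 'I_h.+1) : 'F_p := (i : nat)%:R ^+ 2.
have f_inj : injective f.
  move=> i j /eqP; rewrite eqf_sqr => /orP[]/eqP ij; apply: val_inj.
    exact: (Fp_natr_inj pr_p (ltp i) (ltp j)).
  (* Since i + j is at most 2h < p, the congruence i = -j leaves only i = j = 0. *)
  have ij0 : (i + j)%N = 0.
    apply: (Fp_natr_inj pr_p); rewrite ?prime_gt0 //.
      by rewrite pE ltnS leq_add // -ltnS.
    by rewrite natrD ij addNr.
  by move/eqP: ij0; rewrite addn_eq0 => /andP[/eqP/= -> /eqP/= ->].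
pose g (i : 'I_h.+1) : 'F_p := -1 - f i.
have g_inj : injective g by move=> i j /addrI/oppr_inj/f_inj.
have : f @: setT :&: g @: setT != set0.
  apply/eqP=> fg0; have := cardsUI (f @: setT) (g @: setT).
  rewrite fg0 cards0 addn0 !card_imset // cardsT card_ord => cU.
  have := subset_leq_card (subsetT (f @: setT :|: g @: setT)).
  by rewrite cU cardsT card_Fp // [leqRHS]pE addSn addnS ltnn.
case/set0Pn=> x /setIP[/imsetP[i _ ->] /imsetP[j _ fg]].
by exists i%:R, j%:R; rewrite -/(f i) -/(f j) fg subrK.
Qed.

Lemma quaternion_matrices (R : comNzRingType) (a b : R) :
  a ^+ 2 + b ^+ 2 = -1 ->
  exists X Y : 'M[R]_2, [/\ X * X = -1, Y * Y = -1 & Y * X = - (X * Y)].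
Proof.
move=> ab.
(* Splitting into 1 by 1 scalar blocks reduces matrix products to [mulmx_block]. *)
pose M (s t u v : R) : 'M_(1 + 1) := block_mx s%:M t%:M u%:M v%:M.
have MM s t u v s' t' u' v' : M s t u v *m M s' t' u' v' =
  M (s * s' + t * u') (s * t' + t * v') (u * s' + v * u') (u * t' + v * v').
  by rewrite mulmx_block -!scalar_mxM -!raddfD.
have M1 : -1 = M (-1) 0 0 (-1).
  by rewrite -[-1 : 'M_2]/(- 1%:M) -raddfN /M raddf0 -scalar_mx_block.
have MN s t u v : - M s t u v = M (- s) (- t) (- u) (- v).
  by rewrite opp_block_mx -!raddfN.
(* X is the rotation by a quarter turn; Y is symmetric of trace 0, so it anticommutes with X and its
   square is the scalar a^2 + b^2. *)
exists (M 0 (-1) 1 0), (M a b b (- a)).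
rewrite M1 -!mulmxE !MM MN.
split; congr M;
  rewrite ?(mul0r, mulr0, add0r, addr0, mulr1, mul1r, mulN1r, mulrN1, opprK) //.
all: rewrite -?ab ?expr2 ?mulNr ?mulrN ?opprK //.
all: by rewrite ?[b * a]mulrC ?subrr ?addNr // addrC.
Qed.

End Construction.

Theorem theorem3p7 (p : nat) (hp : prime p) (hp8 : p = 3 %[mod 8]) :
  exists (gT : finGroupType) (G : {group gT}),
    [/\ solvable G, derived_length_is G 4, fitting_height_is G 2
      & cd G =i [:: 1%R; 2%:R%R; 8%:R%R; ((2 * p ^ 2)%N)%:R%R] ].
Proof.
have odd_p : odd p by rewrite (divn_eq p 8) hp8 oddD oddM andbF.
have p_gt2 := odd_prime_gt2 odd_p hp.
have F2 : (2%:R != 0 :> 'F_p)%R.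
  by apply/eqP=> /(Fp_natr_inj hp p_gt2 (prime_gt0 hp)).
have [a [b /quaternion_matrices[X [Y [X2 Y2 YX]]]]] := Fp_sum_two_squares hp odd_p.
exists (q8_heis X2 Y2 YX), [set: q8_heis X2 Y2 YX]%G; split.
- exact: q8_heis_solvable.
- exact: q8_heis_derived_length.
- exact: q8_heis_fitting_height.
- by have := cd_q8_heis X2 Y2 YX F2; rewrite card_Fp.
Qed.
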